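(* Let $n\ge1$ and let $\pi_t$ be the law at time $t$ of the symmetric Ehrenfest urn with $n$ balls started at $\pi_0=\delta_n$ (state $n$). For every $t\ge0$ and every $k\in\{0,\dots,n\}$, $$\sqrt{\pi_t(k)}=\langle k|\,e^{-i\theta(t)J_y}\,|n\rangle,\qquad \theta(t)=\arccos\bigl(e^{-2t}\bigr),$$ and the right side is real and nonnegative. Consequently, the Fisher–Rao lift $\sigma^{\mathrm{FR}}_t:=|\sqrt{\pi_t}\rangle\langle\sqrt{\pi_t}|$ satisfies $$\sigma^{\mathrm{FR}}_t=e^{-i\theta(t)J_y}\,|n\rangle\langle n|\,e^{i\theta(t)J_y},$$ so the Fisher–Rao lift of the relaxing law is a rigid rotation of a spin coherent state about the $y$ axis, run on the clock $\theta(t)$.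
   Context: The symmetric Ehrenfest urn with $n$ balls is the continuous-time Markov chain on $\{0,\dots,n\}$ with generator $Q_{k,k-1}=k$, $Q_{k,k+1}=n-k$, $Q_{kk}=-n$, all other entries zero; its law is the column vector $\pi_t=e^{tQ^{T}}\pi_0$. $|k\rangle$, $k\in\{0,\dots,n\}$, is the standard basis of $\mathbb{C}^{n+1}$, and $|\sqrt\pi\rangle$ is the column vector with components $\sqrt{\pi(k)}$. Spin-$\tfrac n2$ matrices in this basis: $J_z|k\rangle=(k-\tfrac n2)|k\rangle$; $J_x$ is real symmetric tridiagonal with zero diagonal and $(J_x)_{k+1,k}=\tfrac12\sqrt{(k+1)(n-k)}$; $J_y$ is Hermitian tridiagonal with zero diagonal and $(J_y)_{k+1,k}=-i(J_x)_{k+1,k}$, $(J_y)_{k,k+1}=i(J_x)_{k,k+1}$. *)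

(* Defs.v *)
From HB Require Import structures.
From mathcomp Require Import all_boot all_order all_algebra.
From mathcomp Require Import complex.
From mathcomp Require Import all_classical all_reals all_analysis.

Set Implicit Arguments.
Unset Strict Implicit.
Unset Printing Implicit Defensive.

Import Order.TTheory GRing.Theory Num.Theory.
Import numFieldNormedType.Exports.

Local Open Scope classical_set_scope.
Local Open Scope ring_scope.
Local Open Scope complex_scope.
Local Open Scope sesquilinear_scope.

(* The matrix exponential sum_k A^k / k!, the limit being taken in the
   normed topology of square matrices. *)
Definition expmx (K : numFieldType) (m : nat) (A : 'M[K]_m.+1) : 'M[K]_m.+1 :=
  limn (series (fun k : nat => (k`!%:R)^-1 *: A ^+ k)).

Definition ehrenfest_gen (R : realType) (n : nat) : 'M[R]_n.+1 :=
  \matrix_(k < n.+1, l < n.+1)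
    if l == k then - n%:R
    else if k == l.+1 :> nat then k%:R
    else if l == k.+1 :> nat then n%:R - k%:R
    else 0.

Definition ehrenfest_law (R : realType) (n : nat) (p0 : 'cV[R]_n.+1) (t : R) :
    'cV[R]_n.+1 :=
  expmx (t *: (ehrenfest_gen R n)^T) *m p0.

Definition spinJx (R : realType) (n : nat) : 'M[R]_n.+1 :=
  \matrix_(k < n.+1, l < n.+1)
    if k == l.+1 :> nat then 2^-1 * Num.sqrt (l.+1%:R * (n%:R - l%:R))
    else if l == k.+1 :> nat then 2^-1 * Num.sqrt (k.+1%:R * (n%:R - k%:R))
    else 0.

Definition spinJy (R : realType) (n : nat) : 'M[R[i]]_n.+1 :=
  \matrix_(k < n.+1, l < n.+1)
    if k == l.+1 :> nat then - 'i * (spinJx R n k l)%:C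
    else if l == k.+1 :> nat then 'i * (spinJx R n k l)%:C
    else 0.

Definition ket (R : realType) (n : nat) (k : 'I_n.+1) : 'cV[R[i]]_n.+1 :=
  delta_mx k 0.

(* [sqrtC] is used rather than [Num.sqrt], which sends negative reals to 0. *)
Definition sqrt_ket (R : realType) (n : nat) (p : 'cV[R]_n.+1) :
    'cV[R[i]]_n.+1 :=
  \col_(k < n.+1) sqrtC (p k 0)%:C.

Definition fisher_rao_lift (R : realType) (n : nat) (p : 'cV[R]_n.+1) :
    'M[R[i]]_n.+1 :=
  sqrt_ket p *m (sqrt_ket p)^t*.

Definition ehrenfest_clock (R : realType) (t : R) : R :=
  acos (expR (- (2 * t))).

(* Main.v *)
Require Import Defs.
From mathcomp Require Import all_boot all_order all_algebra.
From mathcomp Require Import complex.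
From mathcomp Require Import all_classical all_reals all_analysis.
From mathcomp Require Import ring lra.
Import Order.TTheory GRing.Theory Num.Theory.
Import numFieldNormedType.Exports.
Local Open Scope ring_scope.
Local Open Scope complex_scope.
Local Open Scope sesquilinear_scope.

(** Both sides of the claimed identity are matrix exponentials applied to a
    basis vector, so each is the unique solution of a linear differential
    equation, and both equations have explicit solutions of binomial shape.

    The n balls of the urn evolve independently, each one being in the first
    box at time t with probability q = (1 + exp(-2t)) / 2.  Started from the
    full box, the law is thus Binomial(n, q), and one checks that this curve
    solves the forward equation ([ehrenfest_law_binomial]).

    On the quantum side, the entries of -i J_y are real: it is an antisymmetric
    tridiagonal matrix ([spinJy_rotation_gen]).  The top vector is the n-th
    symmetric power of a spin-1/2 state, which the rotation by x turns into
    cos(x/2) |up> + sin(x/2) |down>; its k-th coordinate is therefore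
    sqrt C(n,k) cos(x/2)^k sin(x/2)^(n-k), which solves the rotation equation
    ([rotation_coherent]).

    The square of this amplitude is the binomial weight of parameter
    cos(x/2)^2 = (1 + cos x) / 2 ([coherent_amplitude_sqr]), and the clock is
    chosen so that cos theta = exp(-2t).  As theta lies in [0, pi], the
    half-angle sine and cosine are nonnegative, so the amplitude is the
    nonnegative square root of the law.  The identity between rank-one
    matrices follows by multiplying the vector by its adjoint: the adjoint of
    a real exponential is the exponential of the transpose, and here the
    transposed generator is the opposite one.

    The analytic ingredient is that a solution of v' = X v is
    t |-> exp(t X) v(0) ([expmx_ode_solution]).  It is proved without
    differentiating the exponential: all derivatives of v are X^k v, and the
    remainder of the Taylor formula at 0 tends to zero. *)

Set Implicit Arguments.
Unset Strict Implicit.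

(** * The matrix exponential, entry by entry *)

Local Open Scope classical_set_scope.

Lemma cvg_mx_entry (K : numFieldType) (m n : nat) (U : nat -> 'M[K]_(m, n))
    (L : 'M[K]_(m, n)) :
  (forall i j, (fun N => U N i j) @ \oo --> L i j) -> U @ \oo --> L.
Proof.
move=> UL; apply/cvg_mx_entourageP => A entA.
apply: filter_forall => i; apply: filter_forall => j.
have /cvg_app_entourageP/(_ A entA) := UL i j.
by apply: filterS => N /=; rewrite inE.
Qed.

Lemma continuous_real_complex (R : realType) :
  continuous (real_complex R : R -> (R[i] : numFieldType)).
Proof.
move=> x; apply/cvgrPdist_lt => -[e e'] /=.
rewrite ltcE /= => /andP[/eqP e'0 e0].
apply/nbhs_ballP; exists e => //= y xy.
rewrite -[_ - _]/(x%:C - y%:C) -rmorphB normc_def /=.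
by rewrite expr0n /= addr0 sqrtr_sqr e'0 ltcR.
Qed.

Lemma series_mxE (K : numFieldType) (m n : nat) (U : nat -> 'M[K]_(m, n)) N i j :
  series U N i j = series (fun k => U k i j) N.
Proof. by rewrite /series /= summxE. Qed.

(** The exponential is a [lim], which says nothing unless the series converges;
    entrywise convergence identifies it because the matrix topology is
    Hausdorff. *)
Lemma expmx_cvg (K : numFieldType) (m : nat) (X L : 'M[K]_m.+1) :
  (forall i j, series (fun k => (k`!%:R)^-1 * (X ^+ k) i j) @ \oo --> L i j) ->
  expmx X = L.
Proof.
move=> XL; rewrite /expmx; apply: cvg_lim; first exact: norm_hausdorff.
apply: cvg_mx_entry => i j; rewrite (_ : (fun N => _) =
  series (fun k => (k`!%:R)^-1 * (X ^+ k) i j)); first exact: XL.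
apply/funext => N; rewrite series_mxE; congr series.
by apply/funext => k; rewrite mxE.
Qed.

Definition mx_norm1 (R : realType) (m : nat) (X : 'M[R]_m.+1) : R :=
  \sum_i \sum_j `|X i j|.

Lemma mx_norm1_ge0 (R : realType) (m : nat) (X : 'M[R]_m.+1) : 0 <= mx_norm1 X.
Proof. by apply: sumr_ge0 => i _; apply: sumr_ge0. Qed.

(** The entrywise l1 norm is submultiplicative and dominates every entry. *)
Lemma normr_expr_mx_le (R : realType) (m : nat) (X : 'M[R]_m.+1) k i j :
  `|(X ^+ k) i j| <= mx_norm1 X ^+ k.
Proof.
elim: k i j => [|k IHk] i j.
  by rewrite !expr0 mxE; case: eqP => _; rewrite ?normr1// normr0.
rewrite !exprS mxE (le_trans (ler_norm_sum _ _ _))//.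
apply: (@le_trans _ _ (\sum_l `|X i l| * mx_norm1 X ^+ k)).
  by apply: ler_sum => l _; rewrite normrM ler_wpM2l.
rewrite -mulr_suml ler_wpM2r ?exprn_ge0 ?mx_norm1_ge0// [leRHS](bigD1 i)//= lerDl.
by apply: sumr_ge0 => a _; apply: sumr_ge0.
Qed.

(** Each entry is dominated by the scalar exponential series of the norm. *)
Lemma expmx_entry_cvg (R : realType) (m : nat) (X : 'M[R]_m.+1) i j :
  series (fun k => (k`!%:R)^-1 * (X ^+ k) i j) @ \oo --> expmx X i j.
Proof.
have cvgX a b : cvgn (series (fun k => (k`!%:R)^-1 * (X ^+ k) a b)).
  apply: normed_cvg.
  apply: (series_le_cvg _ _ _ (is_cvg_series_exp_coeff (mx_norm1 X))).
  - by move=> k; exact: normr_ge0.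
  - move=> k; rewrite /exp_coeff /= divr_ge0//.
    by rewrite exprn_ge0// mx_norm1_ge0.
  - move=> k; rewrite /exp_coeff /= normrM mulrC normfV normr_nat.
    by rewrite ler_wpM2r ?invr_ge0// normr_expr_mx_le.
pose L := \matrix_(a, b) limn (series (fun k => (k`!%:R)^-1 * (X ^+ k) a b)).
rewrite (@expmx_cvg _ _ X L) => [|a b]; first by rewrite mxE; exact: cvgX.
by rewrite mxE; exact: cvgX.
Qed.

(** The partial sums over K are the images of the real ones, so they converge
    without any completeness of K; this is how complex matrices with real
    entries are exponentiated. *)
Lemma expmx_map (R : realType) (K : numFieldType) (f : {rmorphism R -> K})
    (m : nat) (X : 'M[R]_m.+1) :
  continuous f -> expmx (map_mx f X) = map_mx f (expmx X).
Proof.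
move=> fcont; apply: expmx_cvg => i j; rewrite mxE.
rewrite (_ : series _ = f \o series (fun k => (k`!%:R)^-1 * (X ^+ k) i j)).
  exact: cvg_comp (@expmx_entry_cvg _ _ X i j) (fcont _).
apply/funext => N; rewrite /series /= rmorph_sum /=; apply: eq_bigr => k _.
by rewrite rmorphM fmorphV rmorph_nat -(rmorphXn (map_mx f)) mxE.
Qed.

Lemma trmx_expr (R : comNzRingType) (m : nat) (X : 'M[R]_m.+1) k :
  X^T ^+ k = (X ^+ k)^T.
Proof.
elim: k => [|k IHk]; first by rewrite !expr0 trmx1.
by rewrite exprS exprSr IHk; exact/esym/trmx_mul.
Qed.

Lemma expmx_tr (R : realType) (m : nat) (X : 'M[R]_m.+1) :
  expmx X^T = (expmx X)^T.
Proof.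
apply: expmx_cvg => i j; rewrite mxE (_ : (fun k => _) =
  fun k => (k`!%:R)^-1 * (X ^+ k) j i); first exact: expmx_entry_cvg.
by apply/funext => k; rewrite trmx_expr mxE.
Qed.

(** * Linear differential equations *)

(** When g k is the k-th derivative of g 0, the Taylor polynomial of g 0 taken
    at a moving point s and evaluated at t has a telescoping derivative in s.
    It interpolates between the Taylor sum at s = 0 and the value g 0 t at
    s = t, so the mean value theorem yields the remainder. *)
Lemma is_derive_taylor_sum (R : realType) (g : nat -> R -> R) (t : R) (N : nat)
    (s : R) :
  (forall k (s : R), is_derive s 1 (g k) (g k.+1 s)) ->
  is_derive s 1 (fun s => \sum_(k < N.+1) g k s * ((t - s) ^+ k / k`!%:R))
    (g N.+1 s * ((t - s) ^+ N / N`!%:R)).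
Proof.
move=> dg; elim: N => [|N IHN].
  rewrite (_ : (fun s => _) = g 0%N).
    by apply: is_derive_eq (dg 0%N s) _; rewrite expr0 divr1 mulr1.
  by apply/funext => u; rewrite big_ord1 expr0 divr1 mulr1.
have dp : is_derive s 1 (fun s => (t - s) ^+ N.+1 / N.+1`!%:R)
    (- ((t - s) ^+ N / N`!%:R)).
  rewrite (_ : (fun s => _) = N.+1`!%:R^-1 *: ((cst t - id) ^+ N.+1 : R -> R)).
    apply: is_derive_eq.
    rewrite /GRing.scale /= !fctE /= factS natrM.
    have f0 : N`!%:R != 0 :> R by rewrite pnatr_eq0 -lt0n fact_gt0.
    have N0 : N.+1%:R != 0 :> R by rewrite pnatr_eq0.
    by field; rewrite f0 nat1r.
  by apply/funext => u; rewrite mulrC !fctE.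
rewrite (_ : (fun s => _) =
  (fun s => \sum_(k < N.+1) g k s * ((t - s) ^+ k / k`!%:R))
  \+ g N.+1 * (fun s => (t - s) ^+ N.+1 / N.+1`!%:R)); last first.
  by apply/funext => u; rewrite big_ord_recr.
apply: (is_derive_eq (is_deriveD IHN (is_deriveM (dg N.+1 s) dp))).
by rewrite /GRing.scale /=; ring.
Qed.

(** The derivatives of the i-th coordinate of v are the i-th coordinates of
    X^k v, which are bounded by a constant times M^k on [0, t], where M is the
    entrywise norm of X; the Taylor remainder of order N is then at most a
    constant times (M t)^N / N!. *)
Lemma expmx_ode_solution (R : realType) (m : nat) (X : 'M[R]_m.+1)
    (v : R -> 'cV[R]_m.+1) (t : R) :
  0 <= t ->
  (forall (s : R) i, is_derive s 1 (fun s => v s i 0) ((X *m v s) i 0)) ->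
  v t = expmx (t *: X) *m v 0.
Proof.
move=> t0 dv; apply/colP => i.
have vcont j : continuous (fun s => v s j 0).
  move=> s; apply/differentiable_continuous/derivable1_diffP.
  by have [] := dv s j.
pose g k s := (X ^+ k *m v s) i 0.
have dg k (s : R) : is_derive s 1 (g k) (g k.+1 s).
  rewrite (_ : g k = \sum_j (X ^+ k) i j *: (fun s => v s j 0)).
    apply: is_derive_eq.
    by rewrite /g exprSr -mulmxA [RHS]mxE.
  by apply/funext => u; rewrite /g mxE fct_sumE.
(* A common bound for the coordinates of v, by compactness of [0, t]. *)
have [c _ cmax] : exists2 c, c \in `[0, t]%R &
    forall s, s \in `[0, t]%R -> \sum_j `|v s j 0| <= \sum_j `|v c j 0|.
  apply: EVT_max => //; apply: continuous_subspaceT => s.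
  apply: (cvg_big (op := +%R)); first exact: add_continuous.
  by move=> j _; apply: cvg_norm; exact: vcont.
set V := \sum_j `|v c j 0| in cmax.
have gV k s : s \in `[0, t]%R -> `|g k s| <= mx_norm1 X ^+ k * V.
  move=> st; rewrite /g mxE (le_trans (ler_norm_sum _ _ _))//.
  apply: (@le_trans _ _ (\sum_j mx_norm1 X ^+ k * `|v s j 0|)).
    by apply: ler_sum => j _; rewrite normrM ler_wpM2r ?normr_expr_mx_le.
  by rewrite -mulr_sumr ler_wpM2l ?cmax// exprn_ge0// mx_norm1_ge0.
pose S N := \sum_(k < N.+1) g k 0 * (t ^+ k / k`!%:R).
have Sbound N : `|v t i 0 - S N| <=
    mx_norm1 X * V * t * exp_coeff (mx_norm1 X * t) N.
  pose h s := \sum_(k < N.+1) g k s * ((t - s) ^+ k / k`!%:R).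
  have dh (s : R) : is_derive s 1 h (g N.+1 s * ((t - s) ^+ N / N`!%:R)).
    exact: is_derive_taylor_sum.
  have [] := @MVT_segment _ h _ 0 t t0 (fun s _ => dh s).
    apply: continuous_subspaceT => s.
    apply/differentiable_continuous/derivable1_diffP.
    by have [] := dh s.
  move=> s st; rewrite subr0.
  have -> : h t = v t i 0.
    rewrite /h big_ord_recl big1 => [|k _].
      by rewrite subrr expr0 divr1 mulr1 addr0 /g expr0 mul1mx.
    by rewrite subrr expr0n mul0r mulr0.
  have -> : h 0 = S N by rewrite /h subr0.
  move=> ->.
  have /andP[s0 sle] : 0 <= s <= t by move: st; rewrite in_itv.
  rewrite !normrM (ger0_norm t0) normfV normr_nat normrX.
  rewrite (_ : _ * t * _ =
    (mx_norm1 X ^+ N.+1 * V) * (t ^+ N / N`!%:R) * t); last first.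
    by rewrite /exp_coeff /= exprS exprMn; ring.
  rewrite ler_wpM2r// ler_pM//; first exact: gV.
  by rewrite ler_wpM2r// lerXn2r ?nnegrE// ger0_norm; lra.
have Svt : S @ \oo --> v t i 0.
  apply/cvgrPdist_le => e e0.
  pose b := mx_norm1 X * V * t.
  have : b * exp_coeff (mx_norm1 X * t) N @[N --> \oo] --> b * 0.
    by apply: cvgMl_tmp; exact: cvg_exp_coeff.
  rewrite mulr0 => /cvgrPdist_le/(_ e e0); apply: filterS => N.
  rewrite sub0r normrN => H; apply: le_trans (Sbound N) _.
  by apply: le_trans H; exact: ler_norm.
have Sexp : S @ \oo --> (expmx (t *: X) *m v 0) i 0.
  rewrite mxE.
  rewrite (_ : S = fun N => \sum_j
     series (fun k => (k`!%:R)^-1 * ((t *: X) ^+ k) i j) N.+1 * v 0 j 0).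
    apply: (cvg_big (op := +%R)); first exact: add_continuous.
    move=> j _; apply: cvgMr_tmp; rewrite (cvg_shiftS (series _)).
    exact: expmx_entry_cvg.
  apply/funext => N; rewrite /S /series /=.
  under [RHS]eq_bigr do rewrite mulr_suml.
  rewrite exchange_big /= big_mkord; apply: eq_bigr => k _.
  rewrite /g mxE mulr_suml; apply: eq_bigr => j _.
  by rewrite exprZn mxE; ring.
exact: cvg_unique Svt Sexp.
Qed.

Local Close Scope classical_set_scope.

(** * The law of the urn is binomial *)

(** With [sum_ord_succ], this evaluates the rows of a tridiagonal matrix: the
    boundary rows are the cases in which the truth value on the right is 0. *)
Lemma sum_ord_pred (R : pzRingType) n (k : 'I_n.+1) (g : nat -> R) :
  \sum_(l < n.+1) (k == l.+1 :> nat)%:R * g l = (0 < k)%:R * g k.-1.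
Proof.
case: k => -[|k] hk /=; first by rewrite mul0r big1// => l _; rewrite mul0r.
rewrite (bigD1 (Ordinal (ltnW hk)))//= eqxx big1 ?addr0// => l /eqP ne.
by rewrite eqSS; case: eqP => [e|]; rewrite ?mul0r//; case: ne; exact/val_inj.
Qed.

Lemma sum_ord_succ (R : pzRingType) n (k : 'I_n.+1) (g : nat -> R) :
  \sum_(l < n.+1) (l == k.+1 :> nat)%:R * g l = (k < n)%:R * g k.+1.
Proof.
case: ltnP => [kn|nk]; last first.
  rewrite mul0r big1// => l _; case: eqP => [e|]; rewrite ?mul0r//.
  by have := ltn_ord l; rewrite e ltnS ltnNge nk.
rewrite (bigD1 (Ordinal (kn : k.+1 < n.+1)%N))//= eqxx big1 ?addr0// => l /eqP ne.
by case: eqP => [e|]; rewrite ?mul0r//; case: ne; exact/val_inj.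
Qed.

(** Every binomial-shaped curve with parameters q = 1 and r = 0 is the top
    basis vector: this is the initial condition of both flows. *)
Lemma expr1_expr0_ord (R : pzRingType) n (k : 'I_n.+1) (c : R) :
  (k = n :> nat -> c = 1) ->
  c * (1 ^+ k * 0 ^+ (n - k)) = (k == ord_max)%:R.
Proof.
move=> c1; have kn : (k <= n)%N by rewrite -ltnS.
rewrite expr1n mul1r expr0n subn_eq0 -val_eqE /= eqn_leq kn /=.
case: leqP => nk; last by rewrite mulr0.
by rewrite mulr1 c1//; apply/eqP; rewrite eqn_leq kn.
Qed.

Lemma is_derive_powM (R : realType) (q r : R -> R) (a b s : R) (i j : nat) :
  is_derive s 1 q a -> is_derive s 1 r b ->
  is_derive s 1 (fun s => q s ^+ i * r s ^+ j)
    (i%:R * q s ^+ i.-1 * a * r s ^+ j + j%:R * q s ^+ i * r s ^+ j.-1 * b).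
Proof.
move=> dq dr; rewrite (_ : (fun s => _) = (q ^+ i) * (r ^+ j)).
  by apply: is_derive_eq; rewrite /GRing.scale /= !fctE; ring.
by apply/funext => u; rewrite !fctE.
Qed.

Lemma natr_exprK (R : pzRingType) (x : R) k :
  k%:R * x ^+ k.-1 * x = k%:R * x ^+ k.
Proof. by case: k => [|k]; rewrite ?mul0r// -mulrA -exprSr. Qed.

Definition binomial_weight (R : pzRingType) (n k : nat) (q r : R) : R :=
  'C(n, k)%:R * (q ^+ k * r ^+ (n - k)).

(** The jump rates turn neighbouring weights back into derivatives of the
    monomial q^k r^(n-k): n - (k-1) balls may jump up from k - 1, and
    k + 1 may jump down from k + 1 ([binomial_weight_succ]). *)
Lemma binomial_weight_pred (R : comPzRingType) n k (q r : R) : (k <= n)%N ->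
  (0 < k)%:R * ((n - k.-1)%:R * binomial_weight n k.-1 q r) =
  'C(n, k)%:R * (k%:R * q ^+ k.-1 * r ^+ (n - k).+1).
Proof.
case: k => [|k] kn; rewrite /binomial_weight /=; first by rewrite !(mul0r, mulr0).
by rewrite mul1r mulrA -natrM -mul_bin_left natrM subnSK//; ring.
Qed.

Lemma binomial_weight_succ (R : comPzRingType) n k (q r : R) : (k <= n)%N ->
  (k < n)%:R * (k.+1%:R * binomial_weight n k.+1 q r) =
  'C(n, k)%:R * ((n - k)%:R * q ^+ k.+1 * r ^+ (n - k).-1).
Proof.
rewrite leq_eqVlt => /orP[/eqP ->|kn].
  by rewrite ltnn subnn !(mul0r, mulr0).
rewrite kn /binomial_weight mul1r mulrA -natrM mul_bin_left natrM subnS; ring.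
Qed.

(** With q and r = 1 - q the probabilities that a ball is in the first or the
    second box, q' = r - q and r' = q - r; differentiating the binomial weight
    gives the forward equation because k + (n - k) = n. *)
Lemma ehrenfest_law_binomial (R : realType) (n : nat) (t : R) : 0 <= t ->
  let e := expR (- (2 * t)) in
  ehrenfest_law (delta_mx ord_max 0) t =
    \col_(k < n.+1) binomial_weight n k ((1 + e) / 2) ((1 - e) / 2).
Proof.
move=> t0 e.
pose q (s : R) : R := (1 + expR (- (2 * s))) / 2.
pose r (s : R) : R := (1 - expR (- (2 * s))) / 2.
have dq (s : R) : is_derive s 1 q (r s - q s).
  rewrite (_ : q = 2^-1 *: (cst 1 + expR \o (- (2 *: id)))).
    apply: is_derive_eq.
    by rewrite /GRing.scale /= /q /r !fctE /GRing.scale /=; field.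
  by apply/funext => u; rewrite /q !fctE /GRing.scale /= mulrC.
have dr (s : R) : is_derive s 1 r (q s - r s).
  rewrite [X in is_derive _ _ X _](_ : r = cst 1 - q).
    by apply: is_derive_eq; rewrite sub0r opprB.
  by apply/funext => u; rewrite /q /r !fctE; field.
pose v s : 'cV[R]_n.+1 := \col_(k < n.+1) binomial_weight n k (q s) (r s).
suff dv (s : R) k :
    is_derive s 1 (fun s => v s k 0) (((ehrenfest_gen R n)^T *m v s) k 0).
  rewrite /ehrenfest_law -[RHS]/(v t) (expmx_ode_solution t0 dv).
  congr (_ *m _); apply/colP => k; rewrite !mxE /q /r mulr0 oppr0 expR0.
  rewrite subrr mul0r andbT /binomial_weight.
  rewrite (_ : (1 + 1) / 2 = 1); last by field.
  by rewrite expr1_expr0_ord// => ->; rewrite binn.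
have kn : (k <= n)%N by rewrite -ltnS.
rewrite (_ : (fun s => _) =
  'C(n, k)%:R *: (fun s => q s ^+ k * r s ^+ (n - k))); last first.
  by apply/funext => u; rewrite mxE.
have dqr := is_derive_powM k (n - k) (dq s) (dr s).
apply: is_derive_eq.
rewrite mxE.
pose f l := binomial_weight n l (q s) (r s).
transitivity (- n%:R * f k + (0 < k)%:R * ((n - k.-1)%:R * f k.-1)
              + (k < n)%:R * (k.+1%:R * f k.+1)).
  rewrite binomial_weight_pred// binomial_weight_succ//.
  rewrite /f /binomial_weight /GRing.scale /=.
  (* k q^(k-1) q = k q^k holds also for k = 0, and likewise for r. *)
  have -> : n%:R = k%:R + (n - k)%:R :> R by rewrite -natrD subnKC.
  have := natr_exprK (q s) k; have := natr_exprK (r s) (n - k).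
  rewrite !exprS; move: (q s ^+ k.-1) (r s ^+ (n - k).-1) => x y E1 E2.
  ring: E1 E2.
rewrite -(sum_ord_pred k (fun l => (n - l)%:R * f l)).
rewrite -(sum_ord_succ k (fun l => l%:R * f l)).
rewrite (_ : - n%:R * f k =
  \sum_(l < n.+1) (l == k)%:R * (- n%:R * f l)); last first.
  rewrite (bigD1 k)//= eqxx mul1r big1 ?addr0// => l /negPf ->.
  by rewrite mul0r.
rewrite -!big_split /=; apply: eq_bigr => l _; rewrite !mxE -/(f l).
rewrite (eq_sym k l).
case: (eqVneq l k) => [->|_] /=.
  by rewrite (ltn_eqF (ltnSn k)) !mulr0n mulr1n !mul0r mul1r !addr0.
case: (eqVneq (l : nat) k.+1) => [->|_] /=.
  by rewrite (ltn_eqF (leqW (ltnSn k))) !mulr0n mulr1n !mul0r mul1r !add0r.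
case: (eqVneq (k : nat) l.+1) => [_|_] /=; last by rewrite !mulr0n !mul0r !addr0.
by rewrite mulr0n mulr1n !mul0r mul1r add0r addr0 natrB// -ltnS.
Qed.

(** * Rotation of the top spin state *)

(** The matrix -i J_y, whose entries are real. *)
Definition rotation_gen (R : realType) (n : nat) : 'M[R]_n.+1 :=
  \matrix_(k < n.+1, l < n.+1)
    if k == l.+1 :> nat then - spinJx R n k l
    else if l == k.+1 :> nat then spinJx R n k l
    else 0.

Lemma spinJy_rotation_gen (R : realType) (n : nat) (x : R) :
  (- 'i * x%:C) *: spinJy R n = map_mx (real_complex R) (x *: rotation_gen R n).
Proof.
apply/matrixP => k l.
rewrite [LHS]mxE [spinJy _ _ _ _]mxE [RHS]mxE [(x *: _ : matrix _ _ _) k l]mxE.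
rewrite [rotation_gen _ _ _ _]mxE; move: (spinJx R n k l) => J.
have ii : 'i * 'i = -1 :> R[i] by rewrite -expr2 sqr_i.
case: ifP => _; first by rewrite rmorphM rmorphN /=; ring: ii.
case: ifP => _; first by rewrite rmorphM /=; ring: ii.
by rewrite !mulr0.
Qed.

Lemma spinJx_sym (R : realType) (n : nat) (k l : 'I_n.+1) :
  spinJx R n k l = spinJx R n l k.
Proof.
rewrite !mxE; case: (eqVneq (k : nat) l.+1) => [->|_].
  by rewrite (ltn_eqF (leqW (ltnSn l))).
by [].
Qed.

Lemma tr_rotation_gen (R : realType) (n : nat) :
  (rotation_gen R n)^T = - rotation_gen R n.
Proof.
apply/matrixP => k l; rewrite [LHS]mxE [RHS]mxE ![rotation_gen _ _ _ _]mxE.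
rewrite (spinJx_sym R l k); move: (spinJx R n k l) => J.
case: (eqVneq (k : nat) l.+1) => [->|_].
  by rewrite (ltn_eqF (leqW (ltnSn l))) opprK.
by case: eqP => _; rewrite ?oppr0.
Qed.

(** Coordinates of the n-th symmetric power of the rotated spin-1/2 state. *)
Definition coherent_amplitude (R : realType) (n k : nat) (x : R) : R :=
  Num.sqrt 'C(n, k)%:R * (cos (x / 2) ^+ k * sin (x / 2) ^+ (n - k)).

(** The matrix elements of the ladder operators are the geometric means that
    make square roots of neighbouring binomial coefficients proportional, here
    upwards and in [sqrt_bin_succ] downwards. *)
Lemma sqrt_bin_pred (R : realType) n k : (k < n)%N ->
  Num.sqrt (k.+1%:R * (n%:R - k%:R)) * Num.sqrt 'C(n, k)%:R =
  k.+1%:R * Num.sqrt 'C(n, k.+1)%:R :> R.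
Proof.
move=> kn; rewrite -natrB ?(ltnW kn)// -natrM -sqrtrM// -natrM.
rewrite -mulnA -mul_bin_left mulnA mulnn natrM natrX sqrtrM ?exprn_ge0//.
by rewrite sqrtr_sqr normr_nat.
Qed.

Lemma sqrt_bin_succ (R : realType) n k : (k < n)%N ->
  Num.sqrt (k.+1%:R * (n%:R - k%:R)) * Num.sqrt 'C(n, k.+1)%:R =
  (n - k)%:R * Num.sqrt 'C(n, k)%:R :> R.
Proof.
move=> kn; rewrite -natrB ?(ltnW kn)// -natrM -sqrtrM// -natrM.
rewrite [(k.+1 * _)%N]mulnC -mulnA mul_bin_left mulnA mulnn natrM natrX.
by rewrite sqrtrM ?exprn_ge0// sqrtr_sqr normr_nat.
Qed.

(** Differentiating cos(s/2)^k sin(s/2)^(n-k) lowers one exponent and raises the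
    other, which is how the tridiagonal generator acts. *)
Lemma rotation_coherent (R : realType) (n : nat) (x : R) : 0 <= x ->
  expmx (x *: rotation_gen R n) *m delta_mx ord_max 0 =
    \col_(k < n.+1) coherent_amplitude n k x.
Proof.
move=> x0.
pose q (s : R) : R := cos (s / 2).
pose r (s : R) : R := sin (s / 2).
have dhalf (s : R) : is_derive s 1 (fun u : R => u / 2) 2^-1.
  rewrite (_ : (fun u => _) = 2^-1 *: id).
    by apply: is_derive_eq; rewrite /GRing.scale /= mulr1.
  by apply/funext => u; rewrite mulrC.
have dq (s : R) : is_derive s 1 q (- r s / 2).
  by apply: (is_derive_eq (is_derive1_comp (is_derive_cos _) (dhalf s))).
have dr (s : R) : is_derive s 1 r (q s / 2).
  by apply: (is_derive_eq (is_derive1_comp (is_derive_sin _) (dhalf s))).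
pose v s : 'cV[R]_n.+1 := \col_(k < n.+1) coherent_amplitude n k s.
suff dv (s : R) k :
    is_derive s 1 (fun s => v s k 0) ((rotation_gen R n *m v s) k 0).
  rewrite -[RHS]/(v x) (expmx_ode_solution x0 dv).
  congr (_ *m _); apply/colP => k; rewrite !mxE andbT /coherent_amplitude.
  rewrite mul0r cos0 sin0.
  by rewrite expr1_expr0_ord// => ->; rewrite binn sqrtr1.
have kn : (k <= n)%N by rewrite -ltnS.
rewrite (_ : (fun s => _) =
  Num.sqrt 'C(n, k)%:R *: (fun s => q s ^+ k * r s ^+ (n - k))); last first.
  by apply/funext => u; rewrite mxE.
have dqr := is_derive_powM k (n - k) (dq s) (dr s).
apply: is_derive_eq.
rewrite mxE.
pose f l : R := coherent_amplitude n l s.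
pose w l : R := 2^-1 * Num.sqrt (l.+1%:R * (n%:R - l%:R)).
transitivity ((0 < k)%:R * (- w k.-1 * f k.-1) + (k < n)%:R * (w k * f k.+1)).
  have -> : (0 < k)%:R * (- w k.-1 * f k.-1) =
     Num.sqrt 'C(n, k)%:R *
       (k%:R * q s ^+ k.-1 * (- r s / 2) * r s ^+ (n - k)).
    case: (k : nat) kn => [|j] jn; first by rewrite !(mul0r, mulr0).
    rewrite /w /f /coherent_amplitude /= mul1r -(subnSK jn) exprS.
    have E := @sqrt_bin_pred R _ _ jn.
    rewrite -/(q s) -/(r s); ring: E.
  have -> : (k < n)%:R * (w k * f k.+1) =
     Num.sqrt 'C(n, k)%:R *
       ((n - k)%:R * q s ^+ k * r s ^+ (n - k).-1 * (q s / 2)).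
    case: ltnP => [jn|jn]; last first.
      by move: jn; rewrite -subn_eq0 => /eqP ->; rewrite !(mul0r, mulr0).
    rewrite /w /f /coherent_amplitude /= mul1r -subnS exprS.
    have E := @sqrt_bin_succ R _ _ jn.
    rewrite -/(q s) -/(r s); ring: E.
  by rewrite -mulrDr.
rewrite -(sum_ord_pred k (fun l => - w l * f l)).
rewrite -(sum_ord_succ k (fun l => w l.-1 * f l)).
rewrite -!big_split /=; apply: eq_bigr => l _; rewrite !mxE -/(f l).
case: (eqVneq (k : nat) l.+1) => [->|_] /=.
  by rewrite (ltn_eqF (leqW (ltnSn l))) mulr0n mulr1n !mul0r mul1r !addr0.
case: (eqVneq (l : nat) k.+1) => [->|_] /=; last by rewrite !mulr0n !mul0r !addr0.
by rewrite mulr0n mulr1n !mul0r mul1r add0r.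
Qed.

(** * The square root of the law is a rotated coherent state *)

Lemma adjoint_real_complex (R : realType) (m n : nat) (X : 'M[R]_(m, n)) :
  (map_mx (real_complex R) X)^t* = map_mx (real_complex R) X^T.
Proof.
apply/matrixP => i j; rewrite !mxE; apply: CrealP.
by rewrite complex_real.
Qed.

Lemma ket_real_complex (R : realType) (n : nat) (k : 'I_n.+1) :
  ket R k = map_mx (real_complex R) (delta_mx k 0).
Proof. by rewrite map_delta_mx. Qed.

(** The half angle lies in [0, pi/2]. *)
Lemma coherent_amplitude_ge0 (R : realType) (n k : nat) (x : R) :
  0 <= x <= pi -> 0 <= coherent_amplitude n k x.
Proof.
move=> /andP[x0 xpi]; rewrite /coherent_amplitude mulr_ge0 ?sqrtr_ge0//.
rewrite mulr_ge0// exprn_ge0//; last by apply: sin_ge0_pi; lra.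
by apply: cos_ge0_pihalf; have := pi_gt0 R; lra.
Qed.

(** By the half-angle formulas, cos(x/2)^2 and sin(x/2)^2 are affine in cos x. *)
Lemma coherent_amplitude_sqr (R : realType) (n k : nat) (x : R) :
  coherent_amplitude n k x ^+ 2 =
  binomial_weight n k ((1 + cos x) / 2) ((1 - cos x) / 2).
Proof.
have cx : cos x = cos (x / 2) ^+ 2 *+ 2 - 1.
  by rewrite -cos_mulr2n; congr cos; field.
have -> : (1 + cos x) / 2 = cos (x / 2) ^+ 2 by rewrite cx; field.
have -> : (1 - cos x) / 2 = sin (x / 2) ^+ 2 by rewrite sin2cos2 cx; field.
by rewrite /coherent_amplitude /binomial_weight !exprMn sqr_sqrtr.
Qed.

Lemma ehrenfest_clockP (R : realType) (t : R) : 0 <= t ->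
  0 <= ehrenfest_clock t <= pi /\ cos (ehrenfest_clock t) = expR (- (2 * t)).
Proof.
move=> t0.
have e1 : -1 <= expR (- (2 * t)) <= 1.
  by rewrite (le_trans _ (expR_ge0 _)) ?lerN10//= expR_le1; lra.
by rewrite /ehrenfest_clock acos_ge0// acos_lepi// acosK.
Qed.

Unset Implicit Arguments.
Set Strict Implicit.

Theorem proposition7p14 (R : realType) (n : nat) (hn : (1 <= n)%N)
    (t : R) (ht : 0 <= t) :
  let theta : R := ehrenfest_clock t in
  let p : 'cV[R]_n.+1 := ehrenfest_law (delta_mx ord_max 0) t in
  (forall k : 'I_n.+1,
     let a : R[i] :=
       ((ket R k)^t* *m expmx ((- 'i * theta%:C) *: spinJy R n)
          *m ket R ord_max) 0 0 in
     [/\ sqrtC (p k 0)%:C = a, a \is Num.real & 0 <= a]) /\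
  fisher_rao_lift p =
    expmx ((- 'i * theta%:C) *: spinJy R n)
      *m (ket R ord_max *m (ket R ord_max)^t*)
      *m expmx (('i * theta%:C) *: spinJy R n).
Proof.
move=> theta p.
have [theta_itv cos_theta] : 0 <= theta <= pi /\ cos theta = expR (- (2 * t)).
  exact: ehrenfest_clockP.
have theta0 : 0 <= theta by case/andP: theta_itv.
pose U := expmx (theta *: rotation_gen R n).
have UE : expmx ((- 'i * theta%:C) *: spinJy R n) = map_mx (real_complex R) U.
  by rewrite spinJy_rotation_gen expmx_map//; exact: continuous_real_complex.
have UtE : expmx (('i * theta%:C) *: spinJy R n) = (map_mx (real_complex R) U)^t*.
  rewrite adjoint_real_complex -expmx_tr linearZ /= tr_rotation_gen.
  rewrite scalerN -scaleNr.
  rewrite -expmx_map; last exact: continuous_real_complex.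
  by rewrite -spinJy_rotation_gen rmorphN mulrNN.
have amp k : (map_mx (real_complex R) U *m ket R ord_max) k 0 =
    (coherent_amplitude n k theta)%:C.
  by rewrite ket_real_complex -map_mxM mxE rotation_coherent// mxE.
have sqrt_p k : sqrtC (p k 0)%:C = (coherent_amplitude n k theta)%:C.
  rewrite /p ehrenfest_law_binomial// mxE -cos_theta -coherent_amplitude_sqr.
  by rewrite rmorphXn /= sqrCK// ler0c coherent_amplitude_ge0.
split=> [k a|].
  have -> : a = (coherent_amplitude n k theta)%:C.
    rewrite -amp -UE /a -mulmxA; move: (_ *m ket R ord_max) => w.
    rewrite ket_real_complex adjoint_real_complex trmx_delta map_delta_mx.
    by rewrite -rowE mxE.
  by rewrite sqrt_p complex_real ler0c coherent_amplitude_ge0.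
have sqrt_ketE : sqrt_ket p = map_mx (real_complex R) U *m ket R ord_max.
  by apply/colP => k; rewrite amp mxE sqrt_p.
by rewrite /fisher_rao_lift sqrt_ketE UE UtE trmx_mul map_mxM !mulmxA.
Qed.
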